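(* Let $\mathcal{L}$ be a relational language containing a relation symbol $R$ of arity $n_R \geq 3$, and let $\mathcal{A}$ be an $\mathcal{L}$-structure (with no restrictions imposed on the relation $R$). Then $\mathcal{A}$ has a one-element simple extension: there is a simple $\mathcal{L}$-structure $\mathcal{A}^*$ with $\operatorname{dom}(\mathcal{A}^* ) = \operatorname{dom}(\mathcal{A}) \cup \{x\}$ for a new element $x \notin \operatorname{dom}(\mathcal{A})$, such that $\mathcal{A}$ is a substructure of $\mathcal{A}^*$.
   Context: A relational language $\mathcal{L}$ is a set of relation symbols $R$, each with an arity $n_R \geq 1$. An $\mathcal{L}$-structure $\mathcal{A}$ consists of a ground set $A = \operatorname{dom}(\mathcal{A})$ and a set $R^{\mathcal{A}} \subseteq A^{n_R}$ for each $R \in \mathcal{L}$. $\mathcal{A}$ is a substructure of $\mathcal{B}$ if $A \subseteq B$ and $R^{\mathcal{A}} = R^{\mathcal{B}} \cap A^{n_R}$ for all $R \in \mathcal{L}$. A set $I \subseteq B$ is an interval of $\mathcal{B}$ if for every $R \in \mathcal{L}$, every position $i$, all $x,y \in I$ and all $(n_R-1)$-tuples $(x_1,\ldots,x_{i-1},x_{i+1},\ldots,x_{n_R}) \in B^{n_R-1}\setminus I^{n_R-1}$, we have $(x_1,\ldots,x_{i-1},x,x_{i+1},\ldots,x_{n_R}) \in R^{\mathcal{B}} \iff (x_1,\ldots,x_{i-1},y,x_{i+1},\ldots,x_{n_R}) \in R^{\mathcal{B}}$. The empty set, singletons and $B$ are intervals; others are proper. A structure is simple if it has no proper intervals. *)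

(* Defs.v *)
From mathcomp Require Import all_boot boolp classical_sets.

Set Implicit Arguments.
Unset Strict Implicit.
Unset Printing Implicit Defensive.

Local Open Scope classical_set_scope.

Record language := Language {
  symbol :> Type;
  arity : symbol -> nat;
  arity_gt0 : forall R : symbol, 0 < arity R }.

Record structure (L : language) := Structure {
  dom :> Type;
  rel_of : forall R : L, set ((arity R).-tuple dom) }.

Arguments rel_of {L} s R.

Section Structures.
Variable L : language.

(* Ground sets are types, so the inclusion of [dom A] into [dom B] is an
   injection [f]; then R^A = R^B \cap A^(n_R) says that [f] preserves and
   reflects every relation. *)
Definition substructure (A B : structure L) (f : A -> B) : Prop :=
  injective f /\
  forall (R : L) (t : (arity R).-tuple A),
    rel_of A R t <-> rel_of B R (map_tuple f t).

Definition set_power (T : Type) (I : set T) (n : nat) : set (n.-tuple T) :=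
  [set t | forall k : 'I_n, I (tnth t k)].

(* [insert_at i x t] is (x_1, ..., x_(i-1), x, x_(i+1), ..., x_n), where the
   (n-1)-tuple [t] lists the x_j, j <> i, in order. *)
Definition insert_at (T : Type) (n : nat) (i : 'I_n) (x : T)
    (t : n.-1.-tuple T) : n.-tuple T :=
  [tuple if unlift i j is Some k then tnth t k else x | j < n].

Definition interval (B : structure L) (I : set B) : Prop :=
  forall (R : L) (i : 'I_(arity R)) (x y : B) (t : (arity R).-1.-tuple B),
    I x -> I y -> ~ set_power I t ->
    (rel_of B R (insert_at i x t) <-> rel_of B R (insert_at i y t)).

Definition proper_interval (B : structure L) (I : set B) : Prop :=
  [/\ interval I, I <> set0, (forall x : B, I <> [set x]) & I <> [set: B]].

Definition simple (B : structure L) : Prop :=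
  ~ exists I : set B, proper_interval I.

End Structures.

(* Main.v *)
Require Import Defs.
From mathcomp Require Import all_boot boolp classical_sets.

(* Adjoin [None] to A and let R hold of a new tuple iff it is
   (None, u, v, ...) with u = v or v = None.  Let I be an interval with at
   least two elements.  If None is not in I, then distinct a, b in I are
   separated by (None, a, _, ...), which accepts a and rejects b.  If None and
   some a <> None are in I but z is not, then (None, z, _, ...) accepts None
   and rejects a. *)

Set Implicit Arguments.
Unset Strict Implicit.
Unset Printing Implicit Defensive.

Local Open Scope classical_set_scope.

Lemma neq_set1_ex (T : Type) (I : set T) (a : T) :
  I a -> I <> [set a] -> exists2 b, I b & b <> a.
Proof.
move=> Ia IDa; apply: contrapT => noD; apply: IDa; rewrite eqEsubset.
split=> [b Ib|_ -> //].
by apply: contrapT => ba; apply: noD; exists b.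
Qed.

Lemma nth_insert_at (T : Type) (n : nat) (i : 'I_n) (x x0 : T)
    (t : n.-1.-tuple T) (j : 'I_n) :
  nth x0 (insert_at i x t) j =
  if j == i then x else nth x0 t (unbump i j).
Proof.
rewrite -tnth_nth tnth_mktuple eq_sym.
case: unliftP => [k ->|->]; last by rewrite eqxx.
by rewrite (negPf (neq_lift i k)) (tnth_nth x0) /= bumpK.
Qed.

Section OneElementExtension.
Variables (L : language) (A : structure L).

(* The same rule is used for every symbol, as symbols have no decidable
   equality; [nth] returns [None] beyond the arity. *)
Definition one_point_ext : structure L :=
  @Structure L (option A) (fun R t =>
    (exists2 s, t = map_tuple Some s & rel_of A R s) \/
    [/\ nth None t 0 = None &
        nth None t 1 = nth None t 2 \/ nth None t 2 = None]).

Lemma substructure_one_point_ext : @substructure L A one_point_ext Some.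
Proof.
split=> [a b [] //|R t]; split=> [Rt|]; first by left; exists t.
case=> [[s ts Rs]|[]].
  suff -> : t = s by [].
  have Some_inj : injective (@Some A) by move=> a b [].
  by apply/val_inj/(inj_map Some_inj); exact: (congr1 val ts).
(* A nonempty tuple of [Some] values cannot start with [None]. The empty tuple, where [nth] would
   return the default [None], is excluded by positive arity. *)
case: t => -[|a s] //= tn.
by move: (arity_gt0 R) => /[swap] _; rewrite lt0n eq_sym tn.
Qed.

(** Both [v] and [w] are put into the gap of (None, u, _, None, ...). The entries around the gap do
    not all lie in [I], since [None] or [u] is outside it, so acceptance of [v] forces acceptance of
    [w]. *)
Lemma interval_one_point_ext (R : L) (I : set one_point_ext)
    (u v w : one_point_ext) :
  2 < arity R -> interval I -> I v -> I w -> ~ I None \/ ~ I u ->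
  u = v \/ v = None -> u = w \/ w = None.
Proof.
move=> R3 intI Iv Iw outI uv.
have R1 : 1 < (arity R).-1 by rewrite -ltnS prednK // ltnW // ltnW.
pose t : (arity R).-1.-tuple (option A) :=
  [tuple if k == Ordinal R1 then u else None | k < (arity R).-1].
have t0 : nth None t 0 = None.
  by rewrite -(tnth_nth None t (Ordinal (ltnW R1))) tnth_mktuple.
have t1 : nth None t 1 = u.
  by rewrite -(tnth_nth None t (Ordinal R1)) tnth_mktuple eqxx.
have tI : ~ set_power I t.
  by move=> It; case: outI; [move: (It (Ordinal (ltnW R1)))
    | move: (It (Ordinal R1))]; rewrite (tnth_nth None) /= ?t0 ?t1.
(* Insertion at index 2 leaves indices 0 and 1 unshifted. *)
have nth0 y : nth None (insert_at (Ordinal R3) y t) 0 = None.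
  by have /= -> := nth_insert_at (Ordinal R3) y None t (Ordinal (ltnW (ltnW R3))).
have nth1 y : nth None (insert_at (Ordinal R3) y t) 1 = u.
  by have /= -> := nth_insert_at (Ordinal R3) y None t (Ordinal (ltnW R3)).
have nth2 y : nth None (insert_at (Ordinal R3) y t) 2 = y.
  by have /= -> := nth_insert_at (Ordinal R3) y None t (Ordinal R3).
have [+ _] := intI R (Ordinal R3) v w t Iv Iw tI.
case=> [|[s ts _]|[_]]; first by right; rewrite nth0 nth1 nth2.
  (* A tuple coming from [A] cannot start with [None], so only the new clause can accept [w]. *)
  have := nth0 w; rewrite ts.
  rewrite -(tnth_nth None _ (Ordinal (ltnW (ltnW R3)))).
  by rewrite tnth_map.
by rewrite nth1 nth2.
Qed.

Lemma simple_one_point_ext (R : L) : 2 < arity R -> simple one_point_ext.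
Proof.
move=> R3 [I [intI I0 I1 IT]].
have [IN|IN] := pselect (I None).
  have [b Ib bN] := neq_set1_ex IN (I1 None).
  have [z zI] : exists z, ~ I z.
    by apply/existsNP => allI; apply: IT; rewrite -subTset => z _; exact: allI.
  (* Here [z] is the entry outside [I], and [None] in the gap is accepted whatever [z] is. *)
  have [zb|//] :=
    interval_one_point_ext R3 intI IN Ib (or_intror zI) (or_intror erefl).
  by apply: zI; rewrite zb.
have [a Ia] : I !=set0 by apply/set0P/eqP.
have [b Ib ba] := neq_set1_ex Ia (I1 a).
(* Now the leading [None] is the entry outside [I], which allows [u] = [v] = [a]. *)
have [/esym //|bN] :=
  interval_one_point_ext R3 intI Ia Ib (or_introl IN) (or_introl erefl).
by apply: IN; rewrite -bN.
Qed.

End OneElementExtension.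

Theorem theorem7p2 (L : language) (R : L) (hR : 3 <= arity R)
    (A : structure L) :
  exists (Astar : structure L) (x : Astar) (incl : A -> Astar),
    [/\ ~ range incl x,
        [set: Astar] = range incl `|` [set x],
        substructure incl &
        simple Astar].
Proof.
exists (one_point_ext A), None, Some; split.
- by case.
- apply/esym; rewrite -subTset.
  by case=> [a|] _; [left; exists a|right].
- exact: substructure_one_point_ext.
- exact: simple_one_point_ext hR.
Qed.
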